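(* For any integers $b\ge 3$ and $a$ with $b-1\le a\le 2b-2$, there exist a connected graph $G$ and an edge $e\in E(G)$ such that $\rho_e^o(G)=b$ and $\rho_e^o(G-e)=a$. In addition, for any $a\in\{1,2,3\}$ there exist a connected graph $G$ and an edge $e\in E(G)$ such that $\rho_e^o(G)=2$ and $\rho_e^o(G-e)=a$.
   Context: All graphs are finite and simple. A set $B\subseteq E(G)$ is an edge open packing set (EOP set) of $G$ if for every two distinct edges $e_1,e_2\in B$ there is no edge $f\in E(G)\setminus\{e_1,e_2\}$ joining an endvertex of $e_1$ to an endvertex of $e_2$ (i.e. there is no edge $f$ such that $e_1,f,e_2$ form a path with $f$ in the middle or a triangle). Two edges of $B$ are allowed to share an endvertex. The edge open packing number $\rho_e^o(G)$ is the maximum cardinality of an EOP set of $G$ (the subscript $e$ in $\rho_e^o$ is part of the notation and does not refer to the edge $e$). $G-e$ denotes the graph with vertex set $V(G)$ and edge set $E(G)\setminus\{e\}$. *)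

(* Defs.v *)
From mathcomp Require Import all_boot.

Set Implicit Arguments.
Unset Strict Implicit.
Unset Printing Implicit Defensive.

Record sgraph := SGraph {
  vertex :> finType;
  adj : rel vertex;
  adj_sym : symmetric adj;
  adj_irrefl : irreflexive adj
}.

(* Edges are unordered pairs, represented as sets of endvertices. *)
Definition edges (G : sgraph) : {set {set G}} :=
  [set [set p.1; p.2] | p : G * G & adj p.1 p.2].

Definition connected_graph (G : sgraph) : bool :=
  (0 < #|G|) && [forall x : G, forall y : G, connect (@adj G) x y].

Definition del_adj (G : sgraph) (e : {set G}) : rel G :=
  fun x y => adj x y && ([set x; y] != e).

Lemma del_adj_sym (G : sgraph) (e : {set G}) : symmetric (del_adj e).
Proof. by move=> x y; rewrite /del_adj adj_sym setUC. Qed.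

Lemma del_adj_irrefl (G : sgraph) (e : {set G}) : irreflexive (del_adj e).
Proof. by move=> x; rewrite /del_adj adj_irrefl. Qed.

Definition del_edge (G : sgraph) (e : {set G}) : sgraph :=
  SGraph (del_adj_sym e) (del_adj_irrefl e).

Lemma edges_del_edge (G : sgraph) (e : {set G}) :
  edges (del_edge e) = edges G :\ e.
Proof.
apply/setP=> f; rewrite !inE; apply/imsetP/andP => [[p]|[ne /imsetP[p]]].
  rewrite inE /= /del_adj => /andP[pG pe] ->; split=> //.
  by apply/imsetP; exists p; rewrite ?inE.
by rewrite inE => pG def_f; exists p; rewrite // inE /= /del_adj pG -def_f.
Qed.

(* The edge [f] has one endvertex in [e1] and the other in [e2]. *)
Definition joins (G : sgraph) (f e1 e2 : {set G}) : bool :=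
  [exists u in e1, exists v in e2, f == [set u; v]].

Definition eop_set (G : sgraph) (B : {set {set G}}) : bool :=
  (B \subset edges G) &&
  [forall e1 in B, forall e2 in B, (e1 != e2) ==>
    ~~ [exists f in edges G :\: [set e1; e2], joins f e1 e2]].

(* [set0] is an EOP set, so this is the maximum of a nonempty family. *)
Definition eop_number (G : sgraph) : nat :=
  \max_(B : {set {set G}} | eop_set B) #|B|.

(* Main.v *)
Require Import Defs.
From mathcomp Require Import all_boot.
From mathcomp Require Import zify.

(** A set of edges is an edge open packing exactly when it is the edge set of an
    induced subgraph whose components are stars. Two kinds of graphs then
    realise all pairs of values.

    Take the double star whose centres have [k] and [a - k <= k] leaves, and let
    the edge be the one between the centres. This edge joins every leaf edge at
    one centre to every leaf edge at the other, so a packing lies in the star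
    of a single centre ([eop_number_dstar_leq]), and the larger star, central
    edge included, has [k + 1] edges ([eop_number_dstar_geq]). Without the central
    edge two disjoint stars remain, and all their [a] edges form a packing
    ([eop_number_dstar_del]). With [k = b - 1] the value [a] runs from [b - 1] to
    [2 * b - 2].

    Only the pair of values 2 and 3 is left. The paw, a triangle with one pendant
    edge, has packing number 2 ([eop_number_paw]); deleting the triangle edge
    opposite to the vertex of degree three leaves a star with three edges
    ([eop_number_paw_del]). *)

Set Implicit Arguments.
Unset Strict Implicit.
Unset Printing Implicit Defensive.

(** * Edges and edge open packings of a general graph *)

Lemma edgeE (G : sgraph) (x y : G) : ([set x; y] \in edges G) = adj x y.
Proof.
apply/imsetP/idP => [[[u v]]|xy]; last by exists (x, y); rewrite ?inE.
rewrite inE /= => uv E.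
have := set21 x y; rewrite E => /set2P xuv.
have := set22 x y; rewrite E => /set2P yuv.
have := set21 u v; rewrite -E => /set2P uxy.
have := set22 u v; rewrite -E => /set2P vxy.
have uDv : u <> v by move=> uv'; rewrite uv' adj_irrefl in uv.
case: xuv yuv uxy vxy => -> [] -> //.
- by move=> _ [] /esym /uDv.
- by rewrite adj_sym.
- by move=> [] /uDv.
Qed.

Lemma edgeP (G : sgraph) (f : {set G}) :
  reflect (exists x y, f = [set x; y] /\ adj x y) (f \in edges G).
Proof.
apply: (iffP idP) => [/imsetP[[x y]]|[x [y [-> xy]]]]; last by rewrite edgeE.
by rewrite inE => xy ->; exists x, y.
Qed.

Lemma eop_setP (G : sgraph) (B : {set {set G}}) :
  reflect (B \subset edges G /\
           forall e1 e2 u v, e1 \in B -> e2 \in B -> e1 != e2 ->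
             u \in e1 -> v \in e2 -> adj u v ->
             [set u; v] \in [set e1; e2])
          (eop_set B).
Proof.
apply: (iffP andP) => -[BE H]; split=> //.
- move=> e1 e2 u v e1B e2B e12 ue1 ve2 uv.
  have /forall_inP/(_ _ e2B)/implyP/(_ e12) := (forall_inP H) _ e1B.
  apply: contraNT => uv_out; apply/exists_inP; exists [set u; v].
    by rewrite in_setD uv_out edgeE.
  by apply/exists_inP; exists u => //; apply/exists_inP; exists v.
- apply/forall_inP => e1 e1B; apply/forall_inP => e2 e2B; apply/implyP => e12.
  apply/exists_inP => -[f /setDP[fE f_out]].
  case/exists_inP=> u ue1 /exists_inP[v ve2 /eqP Ef].
  by move: f_out; rewrite Ef (H _ _ _ _ e1B e2B) // -edgeE -Ef.
Qed.

Lemma leq_eop_number (G : sgraph) (B : {set {set G}}) :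
  eop_set B -> #|B| <= eop_number G.
Proof. exact: (@leq_bigmax_cond _ _ (fun B : {set {set G}} => #|B|)). Qed.

Lemma eop_number_leq (G : sgraph) n :
  (forall B : {set {set G}}, eop_set B -> #|B| <= n) -> eop_number G <= n.
Proof. by move=> H; apply/bigmax_leqP. Qed.

(** A star whose leaves are pairwise nonadjacent is an induced subgraph, so an
    edge joining two of its edges must itself be one of them. *)
Lemma star_eop_number (G : sgraph) (c : G) (S : {set G}) :
  {in S, forall x, adj c x} -> {in S &, forall x y, ~~ adj x y} ->
  #|S| <= eop_number G.
Proof.
move=> cS indep; have cNS x : x \in S -> x != c.
  by move=> /cS; apply: contraTneq => ->; rewrite adj_irrefl.
rewrite -(card_in_imset (f := fun x => [set c; x])); last first.
  move=> x y xS yS E; have := set22 c x; rewrite E => /set2P[] // xc.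
  by have := cNS _ xS; rewrite xc eqxx.
apply/leq_eop_number/eop_setP; split.
  by apply/subsetP => _ /imsetP[x xS ->]; rewrite edgeE cS.
move=> _ _ u v /imsetP[x xS ->] /imsetP[y yS ->] _.
case/set2P=> -> /set2P[] ->; rewrite ?adj_irrefl //.
- by rewrite set22.
- by rewrite [[set x; c]]setUC set21.
- by rewrite (negbTE (indep _ _ xS yS)).
Qed.

(** If every edge is pendant, then an edge joining two others would have an
    endvertex of degree one lying on a second edge; so all edges together form
    a packing. *)
Lemma eop_number_pendant (G : sgraph) :
  (forall f, f \in edges G ->
     exists2 w, w \in f & forall e, e \in edges G -> w \in e -> e = f) ->
  eop_number G = #|edges G|.
Proof.
move=> pendant; apply/eqP; rewrite eqn_leq; apply/andP; split.
  by apply: eop_number_leq => B /andP[/subset_leq_card].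
apply/leq_eop_number/eop_setP; split=> // e1 e2 u v e1E e2E _ ue1 ve2 uv.
have [|w /set2P[] -> only] := pendant [set u; v]; first by rewrite edgeE.
- by rewrite -(only e1) // set21.
- by rewrite -(only e2) // set22.
Qed.

Lemma connected_graph_root (G : sgraph) (r : G) :
  (forall x, connect (@adj G) r x) -> connected_graph G.
Proof.
move=> rG; apply/andP; split; first by apply/card_gt0P; exists r.
apply/forallP => x; apply/forallP => y; apply: connect_trans (rG y).
by rewrite (sym_connect_sym (@adj_sym G)).
Qed.

(** * Double stars *)

Section DoubleStar.

Variables (I : finType) (side : pred I).

(** The two centres are the booleans, and the leaf [i] hangs from the centre
    [side i]. *)
Definition dstar_adj : rel (bool + I) := fun x y =>
  match x, y with
  | inl s, inl t => s != t
  | inl s, inr i | inr i, inl s => s == side i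
  | inr _, inr _ => false
  end.

Lemma dstar_adj_sym : symmetric dstar_adj.
Proof. by move=> [s|i] [t|j] //=; rewrite eq_sym. Qed.

Lemma dstar_adj_irrefl : irreflexive dstar_adj.
Proof. by move=> [s|i] //=; rewrite eqxx. Qed.

Definition dstar : sgraph := SGraph dstar_adj_sym dstar_adj_irrefl.

Definition central_edge : {set dstar} := [set inl true; inl false].

Definition leaf_edge (i : I) : {set dstar} := [set inl (side i); inr i].

Lemma mem_leaf_edge i j : (inr i \in leaf_edge j) = (i == j).
Proof. by rewrite !inE. Qed.

Lemma leaf_edge_inj : injective leaf_edge.
Proof.
by move=> i j E; apply/eqP; rewrite -mem_leaf_edge -E mem_leaf_edge.
Qed.

Lemma central_edgeNleaf i : leaf_edge i != central_edge.
Proof.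
apply/eqP => E; have : inr i \in leaf_edge i by rewrite mem_leaf_edge.
by rewrite E !inE.
Qed.

Lemma edges_dstar : edges dstar = central_edge |: [set leaf_edge i | i : I].
Proof.
apply/setP => f; apply/edgeP/setU1P => [[x [y [-> xy]]]|].
  case: x y xy => [s|i] [t|j] //=.
  - by left; case: s t xy => [] [] //= _; rewrite setUC.
  - by move/eqP->; right; apply: imset_f.
  - by move/eqP->; right; rewrite setUC; apply: imset_f.
case=> [->|/imsetP[i _ ->]]; first by exists (inl true), (inl false).
by exists (inl (side i)), (inr i) => /=.
Qed.

Lemma connected_dstar : connected_graph dstar.
Proof.
apply: (@connected_graph_root dstar (inl true)).
have centre s : connect (@adj dstar) (inl true) (inl s).
  by case: s; [apply: connect0 | apply: connect1].
move=> [s|i] //; apply: connect_trans (centre (side i)) _.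
by apply: connect1 => /=.
Qed.

(** Leaf edges at different centres are joined by the central edge, so a
    packing lives in the star of one centre. *)
Lemma eop_number_dstar_leq n :
  (forall s, #|[set i | side i == s]| <= n) -> eop_number dstar <= n.+1.
Proof.
move=> side_leq; apply: eop_number_leq => B /eop_setP[BE Beop].
suff [s Bs] : exists s, forall i, leaf_edge i \in B -> side i == s.
  apply: (@leq_trans #|central_edge |: leaf_edge @: [set i | side i == s]|).
    apply: subset_leq_card; apply/subsetP => f fB.
    have := subsetP BE f fB; rewrite edges_dstar => /setU1P[->|]; first exact: setU11.
    by case/imsetP=> i _ Ef; rewrite Ef in fB *; rewrite !inE imset_f ?orbT ?inE ?Bs.
  rewrite cardsU1 -add1n leq_add ?leq_b1 //.
  by rewrite (leq_trans (leq_imset_card _ _)).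
have [/existsP[i /andP[iB si]]|noB] :=
  boolP [exists i, (leaf_edge i \in B) && side i]; last first.
  exists false => i iB; move/existsPn: noB => /(_ i).
  by rewrite iB /= => /negbTE ->.
exists true => j jB; apply: contraT; rewrite eqb_id => /negbTE sj.
have : central_edge \in [set leaf_edge i; leaf_edge j].
  apply: Beop iB jB _ _ _ _ => //.
  - by apply: contraFneq sj => /leaf_edge_inj <-.
  - by rewrite /leaf_edge si set21.
  - by rewrite /leaf_edge sj set21.
by rewrite !inE !(eq_sym central_edge) !(negbTE (central_edgeNleaf _)).
Qed.

Lemma eop_number_dstar_geq : #|[set i | side i]| < eop_number dstar.
Proof.
pose S : {set dstar} := inl false |: inr @: [set i | side i].
have cardS : #|S| = #|[set i | side i]|.+1.
  rewrite cardsU1 card_imset; last by move=> i j; case.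
  by case: imsetP => [[]|].
rewrite -cardS; apply: (@star_eop_number dstar (inl true)).
  by move=> _ /setU1P[->|/imsetP[i + ->]] /=; rewrite ?inE // => ->.
move=> _ _ /setU1P[->|/imsetP[i + ->]] /setU1P[->|/imsetP[j + ->]] //=.
  by rewrite inE => ->.
by rewrite inE => ->.
Qed.

(** Without its central edge the double star is a disjoint union of two
    stars. *)
Lemma eop_number_dstar_del : eop_number (del_edge central_edge) = #|I|.
Proof.
have E : edges (del_edge central_edge) = [set leaf_edge i | i : I].
  rewrite edges_del_edge edges_dstar setU1K //.
  by apply/imsetP => -[i _ /eqP]; rewrite eq_sym (negbTE (central_edgeNleaf i)).
rewrite eop_number_pendant E ?card_imset //; first exact: leaf_edge_inj.
move=> _ /imsetP[i _ ->]; exists (inr i); first by rewrite mem_leaf_edge.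
by move=> _ /imsetP[j _ ->]; rewrite mem_leaf_edge => /eqP->.
Qed.

End DoubleStar.

(** The double star with [k] leaves at one centre and [a - k] at the other. *)
Lemma eop_number_dstar_attains k a : k <= a <= k.*2 ->
  exists (G : sgraph) (e : {set G}),
    [/\ connected_graph G, e \in edges G,
        eop_number G = k.+1 & eop_number (del_edge e) = a].
Proof.
move=> /andP[ka a2k]; pose side (i : 'I_a) := i < k.
have card_side : #|[set i | side i]| = k.
  by rewrite -sum1dep_card -(big_ord_widen a (fun=> 1)) // sum1_card card_ord.
exists (dstar side), (central_edge side); split.
- exact: connected_dstar.
- by rewrite edges_dstar setU11.
- apply/eqP; rewrite eqn_leq -{2}card_side eop_number_dstar_geq andbT.
  apply: eop_number_dstar_leq => -[].
    by rewrite -card_side; apply/subset_leq_card/subsetP => i; rewrite !inE eqb_id.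
  have -> : [set i | side i == false] = ~: [set i | side i].
    by apply/setP => i; rewrite !inE eqbF_neg.
  rewrite cardsCs setCK card_side card_ord; lia.
- by rewrite eop_number_dstar_del card_ord.
Qed.

(** * The paw *)

(** The apex [None] is adjacent to all other vertices, of which [Some None] is
    pendant while the two [Some (Some _)] form a triangle with the apex. *)
Definition paw_adj : rel (option (option bool)) := fun x y =>
  match x, y with
  | None, Some _ | Some _, None => true
  | Some (Some s), Some (Some t) => s != t
  | _, _ => false
  end.

Lemma paw_adj_sym : symmetric paw_adj.
Proof. by move=> [[s|]|] [[t|]|] //=; rewrite eq_sym. Qed.

Lemma paw_adj_irrefl : irreflexive paw_adj.
Proof. by move=> [[s|]|] //=; rewrite eqxx. Qed.

Definition paw : sgraph := SGraph paw_adj_sym paw_adj_irrefl.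

Definition base_edge : {set paw} := [set Some (Some true); Some (Some false)].

Definition spoke (x : option bool) : {set paw} := [set None; Some x].

Lemma mem_spoke x y : (Some x \in spoke y) = (x == y).
Proof. by rewrite !inE. Qed.

Lemma spoke_inj : injective spoke.
Proof. by move=> x y E; apply/eqP; rewrite -mem_spoke -E mem_spoke. Qed.

Lemma base_edgeNspoke x : spoke x != base_edge.
Proof.
by apply/eqP => E; have := set21 None (Some x : paw); rewrite -/(spoke x) E !inE.
Qed.

Lemma edges_paw : edges paw = base_edge |: [set spoke x | x : option bool].
Proof.
apply/setP => f; apply/edgeP/setU1P => [[x [y [-> xy]]]|].
  case: x y xy => [x|] [y|] //=; last first.
  - by move=> _; right; apply: imset_f.
  - by move=> _; right; rewrite setUC; apply: imset_f.
  case: x y => [s|] [t|] //= st; left.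
  by case: s t st => [] [] //= _; rewrite setUC.
case=> [->|/imsetP[x _ ->]]; first by exists (Some (Some true)), (Some (Some false)).
by exists None, (Some x).
Qed.

Lemma connected_paw : connected_graph paw.
Proof.
apply: (@connected_graph_root paw None) => -[x|]; last exact: connect0.
exact: connect1.
Qed.

(** The edges of the paw split into two pairs, each joined by a third edge: the
    spokes to the triangle by the base, and the pendant spoke and the base by a
    spoke to the triangle. A packing has at most one edge of each pair. *)
Lemma eop_number_paw : eop_number paw = 2.
Proof.
apply/eqP; rewrite eqn_leq; apply/andP; split; last first.
  pose S : {set paw} := [set Some None; Some (Some true)].
  have <- : #|S| = 2 by rewrite cards2.
  apply: (@star_eop_number paw None); first by move=> _ /set2P[] ->.
  by move=> _ _ /set2P[] -> /set2P[] ->.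
apply: eop_number_leq => B /eop_setP[BE Beop].
pose st := spoke (Some true); pose sf := spoke (Some false).
pose P := [set st; sf]; pose Q := [set spoke None; base_edge].
have spokeE x y : (spoke x == spoke y) = (x == y) := inj_eq spoke_inj x y.
have baseE x : (base_edge == spoke x) = false.
  by rewrite eq_sym (negbTE (base_edgeNspoke x)).
have pair_leq e1 e2 : ~~ ((e1 \in B) && (e2 \in B)) -> #|B :&: [set e1; e2]| <= 1.
  rewrite negb_and => /orP[] e_out.
    rewrite -(cards1 e2); apply/subset_leq_card/subsetP => f /setIP[fB].
    by case/set2P=> Ef; rewrite Ef ?set11 // -Ef fB in e_out *.
  rewrite -(cards1 e1); apply/subset_leq_card/subsetP => f /setIP[fB].
  by case/set2P=> Ef; rewrite Ef ?set11 // -Ef fB in e_out *.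
have BPQ : B \subset (B :&: P) :|: (B :&: Q).
  apply/subsetP => f fB; rewrite -setIUr inE fB /=.
  have := subsetP BE f fB; rewrite edges_paw => /setU1P[->|/imsetP[[[]|] _ ->]];
    by rewrite !inE eqxx ?orbT.
apply: leq_trans (subset_leq_card BPQ) _.
apply: leq_trans (leq_card_setU _ _) _.
apply: (@leq_add _ _ 1 1); apply: pair_leq; apply/negP => /andP[e1B e2B].
  have : base_edge \in P.
    by apply: Beop e1B e2B _ _ _ _; rewrite ?spokeE ?set22.
  by rewrite !inE !baseE.
have : st \in Q.
  by apply: Beop e1B e2B _ _ _ _; rewrite ?base_edgeNspoke ?set21.
by rewrite !inE spokeE (negbTE (base_edgeNspoke _)).
Qed.

(** Without the base the paw is a star with three leaves. *)
Lemma eop_number_paw_del : eop_number (del_edge base_edge) = 3.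
Proof.
have E : edges (del_edge base_edge) = [set spoke x | x : option bool].
  rewrite edges_del_edge edges_paw setU1K //.
  by apply/imsetP => -[x _ /eqP]; rewrite eq_sym (negbTE (base_edgeNspoke x)).
rewrite eop_number_pendant E.
  by rewrite card_imset ?card_option ?card_bool //; apply: spoke_inj.
move=> _ /imsetP[x _ ->]; exists (Some x); first by rewrite mem_spoke.
by move=> _ /imsetP[y _ ->]; rewrite mem_spoke => /eqP->.
Qed.

(** * Realising all pairs of values *)

Theorem mainTheorem7 :
  (forall a b : nat, 3 <= b -> b - 1 <= a <= 2 * b - 2 ->
     exists (G : sgraph) (e : {set G}),
       [/\ connected_graph G, e \in edges G,
           eop_number G = b & eop_number (del_edge e) = a]) /\
  (forall a : nat, a \in [:: 1; 2; 3] ->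
     exists (G : sgraph) (e : {set G}),
       [/\ connected_graph G, e \in edges G,
           eop_number G = 2 & eop_number (del_edge e) = a]).
Proof.
split=> [a [//|k] _ a_bounds|a].
  by apply: eop_number_dstar_attains; lia.
rewrite !inE => /or3P[]/eqP->; try exact: (@eop_number_dstar_attains 1).
exists paw, base_edge; split.
- exact: connected_paw.
- by rewrite edges_paw setU11.
- exact: eop_number_paw.
- exact: eop_number_paw_del.
Qed.
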